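(* Let $K$ be a field of characteristic $0$, let $n \geq 4$, let $L_n$ be the free Lie algebra over $K$ freely generated by $x_1,\ldots,x_n$, let $C_n = L_n/\gamma_3(L_n')$, and let $q_j = x_j + \gamma_3(L_n')$ for $j=1,\ldots,n$. For a positive integer $\kappa$, let $\varphi_\kappa$ be the automorphism of $C_n$ satisfying $\varphi_\kappa(q_1) = q_1 + [q_1,q_2,{}_{(\kappa-1)}q_1,[q_3,q_4]]$ and $\varphi_\kappa(q_i) = q_i$ for $i=2,\ldots,n$. Then each $\varphi_\kappa$ is non-tame.
   Context: For a Lie algebra $L$, $\gamma_c(L)$ is the $c$-th term of the lower central series and $L'=\gamma_2(L)$. Commutators are left-normed, and $[a,{}_{m}b]$ denotes the left-normed commutator of $a$ followed by $m$ copies of $b$ (equal to $a$ if $m=0$); thus $[q_1,q_2,{}_{(\kappa-1)}q_1,[q_3,q_4]]=[[q_1,q_2,q_1,\ldots,q_1],[q_3,q_4]]$ with $\kappa-1$ copies of $q_1$ after $q_2$. An automorphism of $C_n$ is tame if it lies in the image of the group homomorphism $\mathrm{Aut}(L_n)\to\mathrm{Aut}(C_n)$ induced by the natural epimorphism $L_n\to C_n$; otherwise it is non-tame. *)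

(* Defs.v *)
From HB Require Import structures.
From mathcomp Require Import all_boot all_order all_algebra.
From mathcomp Require Import boolp.

(* Classical logic (boolp) makes membership in a spanned subspace and the
   congruences below decidable, so that the quotient library applies. *)

Set Implicit Arguments.
Unset Strict Implicit.
Unset Printing Implicit Defensive.

Import GRing.Theory.

Local Open Scope ring_scope.
Local Open Scope quotient_scope.

HB.mixin Record Lmodule_isLieAlgebra (K : fieldType) (L : Type)
    of GRing.Lmodule K L := {
  lie : L -> L -> L;
  lie_linearl : forall (a : K) (x y z : L),
    lie (a *: x + y) z = a *: lie x z + lie y z;
  lie_linearr : forall (a : K) (x y z : L),
    lie z (a *: x + y) = a *: lie z x + lie z y;
  lie_alt : forall x : L, lie x x = 0;
  lie_jacobi : forall x y z : L,
    lie x (lie y z) + lie y (lie z x) + lie z (lie x y) = 0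
}.

#[short(type="lieAlgType")]
HB.structure Definition LieAlgebra (K : fieldType) :=
  {L of GRing.Lmodule K L & Lmodule_isLieAlgebra K L}.

Notation "[lie x , y ]" := (lie x y) (at level 0, x, y at level 99,
  format "[lie  x ,  y ]") : ring_scope.

Section LieTheory.
Variables (K : fieldType) (L : lieAlgType K).
Implicit Types x y z : L.

Lemma lieDl x y z : [lie x + y, z] = [lie x, z] + [lie y, z].
Proof. by have := lie_linearl 1 x y z; rewrite !scale1r. Qed.
Lemma lieDr x y z : [lie z, x + y] = [lie z, x] + [lie z, y].
Proof. by have := lie_linearr 1 x y z; rewrite !scale1r. Qed.
Lemma lie0l z : [lie 0, z] = 0.
Proof. by apply: (addrI [lie 0, z]); rewrite -lieDl !addr0. Qed.
Lemma lie0r z : [lie z, 0] = 0.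
Proof. by apply: (addrI [lie z, 0]); rewrite -lieDr !addr0. Qed.
Lemma lieZl a x z : [lie a *: x, z] = a *: [lie x, z].
Proof. by have := lie_linearl a x 0 z; rewrite lie0l !addr0. Qed.
Lemma lieZr a x z : [lie z, a *: x] = a *: [lie z, x].
Proof. by have := lie_linearr a x 0 z; rewrite lie0r !addr0. Qed.
Lemma lieNl x z : [lie - x, z] = - [lie x, z].
Proof. by rewrite -scaleN1r lieZl scaleN1r. Qed.
Lemma lieNr x z : [lie z, - x] = - [lie z, x].
Proof. by rewrite -scaleN1r lieZr scaleN1r. Qed.
Lemma lieBl x y z : [lie x - y, z] = [lie x, z] - [lie y, z].
Proof. by rewrite lieDl lieNl. Qed.
Lemma lieBr x y z : [lie z, x - y] = [lie z, x] - [lie z, y].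
Proof. by rewrite lieDr lieNr. Qed.
Lemma lieC x y : [lie x, y] = - [lie y, x].
Proof.
apply/eqP; rewrite -addr_eq0; apply/eqP.
by have := lie_alt (x + y); rewrite lieDl !lieDr !lie_alt add0r addr0.
Qed.

(* The left-normed commutator [a, b, ..., b] with m copies of b. *)
Definition lie_iter (m : nat) (a b : L) : L := iter m (fun u => [lie u, b]) a.

End LieTheory.

Definition lie_hom (K : fieldType) (L M : lieAlgType K) (f : L -> M) : Prop :=
  linear f /\ forall x y, f [lie x, y] = [lie f x, f y].

Definition lie_aut (K : fieldType) (L : lieAlgType K) (f : L -> L) : Prop :=
  lie_hom f /\ bijective f.

Section HomTheory.
Variables (K : fieldType) (L M : lieAlgType K) (f : L -> M).
Hypothesis homf : lie_hom f.

Lemma lie_homD x y : f (x + y) = f x + f y.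
Proof. by have := homf.1 1 x y; rewrite !scale1r. Qed.
Lemma lie_hom0 : f 0 = 0.
Proof. by apply: (addrI (f 0)); rewrite -lie_homD !addr0. Qed.
Lemma lie_homZ a x : f (a *: x) = a *: f x.
Proof. by have := homf.1 a x 0; rewrite lie_hom0 !addr0. Qed.
Lemma lie_homN x : f (- x) = - f x.
Proof. by rewrite -scaleN1r lie_homZ scaleN1r. Qed.
Lemma lie_homB x y : f (x - y) = f x - f y.
Proof. by rewrite lie_homD lie_homN. Qed.
Lemma lie_hom_lie x y : f [lie x, y] = [lie f x, f y].
Proof. exact: homf.2. Qed.

Lemma lie_hom_iter m x y : f (lie_iter m x y) = lie_iter m (f x) (f y).
Proof. by elim: m => //= m <-; rewrite lie_hom_lie. Qed.
End HomTheory.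

HB.mixin Record isLieIdeal (K : fieldType) (L : lieAlgType K)
    (I : {pred L}) := {
  lie_ideal_scale : forall (a : K) (x : L), x \in I -> a *: x \in I;
  lie_ideal_bracket : forall x y : L, x \in I -> [lie x, y] \in I
}.

#[short(type="lieIdeal")]
HB.structure Definition LieIdeal (K : fieldType) (L : lieAlgType K) :=
  {I of GRing.ZmodClosed L I & isLieIdeal K L I}.

Section Ideals.
Variables (K : fieldType) (L : lieAlgType K).
Implicit Types A B : {pred L}.

Lemma lie_ideall (I : lieIdeal L) x y : x \in I -> [lie x, y] \in I.
Proof. exact: lie_ideal_bracket. Qed.
Lemma lie_idealr (I : lieIdeal L) x y : y \in I -> [lie x, y] \in I.
Proof. by move=> Iy; rewrite lieC rpredN; apply: lie_ideall. Qed.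

Inductive comm_span A B : L -> Prop :=
| CommSpan0 : comm_span A B 0
| CommSpanD a u v : comm_span A B u -> comm_span A B v ->
    comm_span A B (a *: u + v)
| CommSpanLie x y : x \in A -> y \in B -> comm_span A B [lie x, y].

(* The subspace [A, B] spanned by the brackets [x, y] with x in A, y in B. *)
Definition commp A B : {pred L} := fun u => `[< comm_span A B u >].

(* gamma A c is gamma_c(A) for c >= 1, so gamma A 1 = A (and, by convention,
   gamma A 0 = A); A is to be a subalgebra of L. *)
Definition gamma A (c : nat) : {pred L} := iter c.-1 (fun G => commp G A) A.

Definition lieT : {pred L} := fun=> true.

Lemma commpP A B u : reflect (comm_span A B u) (u \in commp A B).
Proof. exact: asboolP. Qed.

Lemma commp_lie A B x y : x \in A -> y \in B -> [lie x, y] \in commp A B.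
Proof. by move=> Ax By; apply/commpP/CommSpanLie. Qed.

Lemma commp_submod A B : submod_closed (commp A B).
Proof.
split; first exact/commpP/CommSpan0.
by move=> a u v /commpP uP /commpP vP; apply/commpP/CommSpanD.
Qed.

Lemma lieT_zmod : zmod_closed lieT. Proof. by []. Qed.
HB.instance Definition _ := GRing.isZmodClosed.Build L lieT lieT_zmod.
HB.instance Definition _ :=
  isLieIdeal.Build K L lieT (fun _ _ _ => isT) (fun _ _ _ => isT).

Lemma commp_ideal (I J : lieIdeal L) x y :
  x \in commp I J -> [lie x, y] \in commp I J.
Proof.
move=> /commpP; elim=> {x} [|a u v _ IHu _ IHv|u v Iu Jv].
- by rewrite lie0l; case: (commp_submod I J).
- by rewrite lie_linearl; apply: (commp_submod I J).2.
have -> : [lie [lie u, v], y] =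
    (-1) *: [lie [lie y, u], v] + [lie u, [lie v, y]].
  rewrite scaleN1r -lieC [LHS]lieC; apply/esym/eqP.
  by rewrite -addr_eq0 [X in X + _]addrC lie_jacobi.
apply: (commp_submod I J).2; apply: commp_lie => //.
  exact: lie_idealr.
exact: lie_ideall.
Qed.

Section CommIdeal.
Variables I J : lieIdeal L.
HB.instance Definition _ := GRing.isZmodClosed.Build L (commp I J)
  (GRing.submod_closedB (commp_submod I J)).
Lemma commp_scale (a : K) x : x \in commp I J -> a *: x \in commp I J.
Proof.
by move=> Ix; rewrite -[_ *: _]addr0; apply: (commp_submod I J).2 => //;
   apply: rpred0.
Qed.
HB.instance Definition _ :=
  isLieIdeal.Build K L (commp I J) commp_scale (@commp_ideal I J).
End CommIdeal.

Section GammaIdeal.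
Variables (I : lieIdeal L) (c : nat).

Let gammaI : {J : lieIdeal L | gamma I c = J}.
Proof.
rewrite /gamma; elim: c.-1 => [|k [J eJ]]; first by exists I.
by exists (commp J I : lieIdeal L); rewrite /= eJ.
Qed.

Lemma gamma_zmod : zmod_closed (gamma I c).
Proof.
case: gammaI => J ->; split; first exact: rpred0.
by move=> x y; apply: rpredB.
Qed.
Lemma gamma_scale (a : K) x : x \in gamma I c -> a *: x \in gamma I c.
Proof. by case: gammaI => J ->; apply: lie_ideal_scale. Qed.
Lemma gamma_ideal x y : x \in gamma I c -> [lie x, y] \in gamma I c.
Proof. by case: gammaI => J ->; apply: lie_ideall. Qed.

HB.instance Definition _ := GRing.isZmodClosed.Build L (gamma I c) gamma_zmod.
HB.instance Definition _ :=
  isLieIdeal.Build K L (gamma I c) gamma_scale gamma_ideal.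
End GammaIdeal.

End Ideals.

Arguments lieT {K} L.

Section Quotient.
Variables (K : fieldType) (L : lieAlgType K) (I : lieIdeal L).

Definition lie_quot : Type := Quotient.quot I.

HB.instance Definition _ := GRing.Zmodule.on lie_quot.

Definition quo (x : L) : lie_quot := \pi_(Quotient.quot I) x.
Definition quo_repr (u : lie_quot) : L := @repr _ (Quotient.quot I) u.

Lemma quoK u : quo (quo_repr u) = u. Proof. exact: reprK. Qed.

Lemma quoE x y : quo x = quo y <-> x - y \in I.
Proof.
by rewrite Quotient.idealrBE; split=> [|/eqP //]; rewrite /quo => ->.
Qed.

Lemma quoD x y : quo (x + y) = quo x + quo y.
Proof. exact: (@Quotient.pi_add _ I). Qed.

Lemma quo0 : quo 0 = 0.
Proof. by apply: (addrI (quo 0)); rewrite -quoD !addr0. Qed.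

Definition quo_scale (a : K) (u : lie_quot) : lie_quot := quo (a *: quo_repr u).
Definition quo_lie (u v : lie_quot) : lie_quot :=
  quo [lie quo_repr u, quo_repr v].

Lemma quo_scaleE a x : quo_scale a (quo x) = quo (a *: x).
Proof.
apply/quoE; rewrite -scalerBr; apply: lie_ideal_scale.
by apply/quoE; rewrite quoK.
Qed.

Lemma quo_lieE x y : quo_lie (quo x) (quo y) = quo [lie x, y].
Proof.
set x' := quo_repr (quo x); set y' := quo_repr (quo y).
have Ix : x' - x \in I by apply/quoE; rewrite quoK.
have Iy : y' - y \in I by apply/quoE; rewrite quoK.
apply/quoE; rewrite -(subrKA [lie x, y']) -lieBl -lieBr rpredD //.
  exact: lie_ideall.
exact: lie_idealr.
Qed.

Lemma quo_ind (P : lie_quot -> Prop) : (forall x, P (quo x)) -> forall u, P u.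
Proof. by move=> Pq u; rewrite -[u]quoK. Qed.

Lemma quo_scaleA a b u : quo_scale a (quo_scale b u) = quo_scale (a * b) u.
Proof. by elim/quo_ind: u => x; rewrite !quo_scaleE scalerA. Qed.
Lemma quo_scale1 : left_id 1 quo_scale.
Proof. by elim/quo_ind=> x; rewrite !quo_scaleE scale1r. Qed.
Lemma quo_scaleDr : right_distributive quo_scale +%R.
Proof.
move=> a; elim/quo_ind=> x; elim/quo_ind=> y.
by rewrite -quoD !quo_scaleE -quoD scalerDr.
Qed.
Lemma quo_scaleDl u : {morph quo_scale^~ u : a b / a + b}.
Proof. by elim/quo_ind: u => x a b; rewrite !quo_scaleE -quoD scalerDl. Qed.

HB.instance Definition _ := GRing.Zmodule_isLmodule.Build K lie_quot
  quo_scaleA quo_scale1 quo_scaleDr quo_scaleDl.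

Lemma quoZ a x : quo (a *: x) = a *: quo x.
Proof. exact/esym/quo_scaleE. Qed.

Lemma quo_lie_linearl (a : K) (x y z : lie_quot) :
  quo_lie (a *: x + y) z = a *: quo_lie x z + quo_lie y z.
Proof.
elim/quo_ind: x => x; elim/quo_ind: y => y; elim/quo_ind: z => z.
by rewrite -quoZ -quoD !quo_lieE -quoZ -quoD lie_linearl.
Qed.
Lemma quo_lie_linearr (a : K) (x y z : lie_quot) :
  quo_lie z (a *: x + y) = a *: quo_lie z x + quo_lie z y.
Proof.
elim/quo_ind: x => x; elim/quo_ind: y => y; elim/quo_ind: z => z.
by rewrite -quoZ -quoD !quo_lieE -quoZ -quoD lie_linearr.
Qed.
Lemma quo_lie_alt x : quo_lie x x = 0.
Proof. by elim/quo_ind: x => x; rewrite quo_lieE lie_alt quo0. Qed.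
Lemma quo_lie_jacobi x y z :
  quo_lie x (quo_lie y z) + quo_lie y (quo_lie z x) + quo_lie z (quo_lie x y)
  = 0.
Proof.
elim/quo_ind: x => x; elim/quo_ind: y => y; elim/quo_ind: z => z.
by rewrite !quo_lieE -!quoD lie_jacobi quo0.
Qed.

HB.instance Definition _ := Lmodule_isLieAlgebra.Build K lie_quot
  quo_lie_linearl quo_lie_linearr quo_lie_alt quo_lie_jacobi.

Lemma quo_hom : lie_hom quo.
Proof.
by split=> [a x y|x y]; [rewrite quoD quoZ | exact/esym/quo_lieE].
Qed.

Lemma quo_eq0 x : quo x = 0 <-> x \in I.
Proof. by rewrite -quo0 quoE subr0. Qed.

(* The map induced on L / I by a homomorphism that vanishes on I. *)
Lemma lie_hom_lift (M : lieAlgType K) (f : L -> M) :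
  lie_hom f -> (forall x, x \in I -> f x = 0) ->
  exists2 g : lie_quot -> M, lie_hom g & forall x, g (quo x) = f x.
Proof.
move=> homf f0; pose g u := f (quo_repr u).
have gE x : g (quo x) = f x.
  apply/eqP; rewrite -subr_eq0 -(lie_homB homf); apply/eqP/f0.
  by apply/quoE; rewrite quoK.
exists g => //; split=> [a|]; elim/quo_ind=> x; elim/quo_ind=> y.
  by rewrite -quoZ -quoD !gE homf.1.
by rewrite -(lie_hom_lie quo_hom) !gE homf.2.
Qed.
End Quotient.

Section FreeLie.
Variables (K : fieldType) (n : nat).

Inductive lterm :=
| TGen of 'I_n
| TZero
| TAdd of lterm & lterm
| TScale of K & lterm
| TLie of lterm & lterm.

(* The smallest congruence containing the axioms of a Lie algebra over K. *)
Inductive lteq : lterm -> lterm -> Prop :=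
| TRefl s : lteq s s
| TSym s t : lteq s t -> lteq t s
| TTrans s t u : lteq s t -> lteq t u -> lteq s u
| TAddC s t s' t' : lteq s s' -> lteq t t' -> lteq (TAdd s t) (TAdd s' t')
| TScaleC a s s' : lteq s s' -> lteq (TScale a s) (TScale a s')
| TLieC s t s' t' : lteq s s' -> lteq t t' -> lteq (TLie s t) (TLie s' t')
| TaddA s t u : lteq (TAdd s (TAdd t u)) (TAdd (TAdd s t) u)
| Taddc s t : lteq (TAdd s t) (TAdd t s)
| Tadd0 s : lteq (TAdd TZero s) s
| TaddN s : lteq (TAdd (TScale (-1) s) s) TZero
| TscaleA a b s : lteq (TScale a (TScale b s)) (TScale (a * b) s)
| Tscale1 s : lteq (TScale 1 s) s
| TscaleDr a s t : lteq (TScale a (TAdd s t)) (TAdd (TScale a s) (TScale a t))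
| TscaleDl a b s : lteq (TScale (a + b) s) (TAdd (TScale a s) (TScale b s))
| Tlinl a s t u : lteq (TLie (TAdd (TScale a s) t) u)
                       (TAdd (TScale a (TLie s u)) (TLie t u))
| Tlinr a s t u : lteq (TLie u (TAdd (TScale a s) t))
                       (TAdd (TScale a (TLie u s)) (TLie u t))
| Talt s : lteq (TLie s s) TZero
| Tjacobi s t u :
    lteq (TAdd (TAdd (TLie s (TLie t u)) (TLie t (TLie u s)))
               (TLie u (TLie s t))) TZero.

HB.instance Definition _ := gen_eqMixin lterm.
HB.instance Definition _ := gen_choiceMixin lterm.

Definition lteqb : rel lterm := fun s t => `[< lteq s t >].

Lemma lteqb_equiv : equiv_class_of lteqb.
Proof.
split=> [s|s t|t s u]; first exact/asboolP/TRefl.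
  by apply: asbool_equiv_eq; split; apply: TSym.
by move=> /asboolP st /asboolP tu; apply/asboolP; apply: TTrans tu.
Qed.
Canonical lteqb_equivrel := EquivRelPack lteqb_equiv.
Canonical lteqb_encModRel := defaultEncModRel lteqb.

Definition freeLie : Type := {eq_quot lteqb}.
HB.instance Definition _ := Choice.on freeLie.

Definition tcl (s : lterm) : freeLie := \pi_({eq_quot lteqb}) s.
Definition trepr (u : freeLie) : lterm := @repr _ {eq_quot lteqb} u.

Lemma treprK u : tcl (trepr u) = u. Proof. exact: reprK. Qed.
Lemma tclE s t : tcl s = tcl t <-> lteq s t.
Proof.
have: (tcl s == tcl t) = lteqb s t by rewrite /tcl piE.
move=> e; split=> [/eqP|st]; first by rewrite e => /asboolP.
by apply/eqP; rewrite e; apply/asboolP.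
Qed.
Lemma tcl_ind (P : freeLie -> Prop) : (forall s, P (tcl s)) -> forall u, P u.
Proof. by move=> Ps u; rewrite -[u]treprK. Qed.
Lemma trepr_tcl s : lteq (trepr (tcl s)) s.
Proof. by apply/tclE; rewrite treprK. Qed.

Definition fl0 := tcl TZero.
Definition fl_add u v := tcl (TAdd (trepr u) (trepr v)).
Definition fl_scale a u := tcl (TScale a (trepr u)).
Definition fl_opp u := fl_scale (-1) u.
Definition fl_lie u v := tcl (TLie (trepr u) (trepr v)).

Lemma fl_addE s t : fl_add (tcl s) (tcl t) = tcl (TAdd s t).
Proof. by apply/tclE/TAddC; apply: trepr_tcl. Qed.
Lemma fl_scaleE a s : fl_scale a (tcl s) = tcl (TScale a s).
Proof. by apply/tclE/TScaleC; apply: trepr_tcl. Qed.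
Lemma fl_lieE s t : fl_lie (tcl s) (tcl t) = tcl (TLie s t).
Proof. by apply/tclE/TLieC; apply: trepr_tcl. Qed.
Definition flE := (fl_addE, fl_scaleE, fl_lieE).

Lemma fl_addA : associative fl_add.
Proof.
elim/tcl_ind=> s; elim/tcl_ind=> t; elim/tcl_ind=> u.
by rewrite !flE; apply/tclE/TaddA.
Qed.
Lemma fl_addC : commutative fl_add.
Proof.
by elim/tcl_ind=> s; elim/tcl_ind=> t; rewrite !flE; apply/tclE/Taddc.
Qed.
Lemma fl_add0 : left_id fl0 fl_add.
Proof. by elim/tcl_ind=> s; rewrite !flE; apply/tclE/Tadd0. Qed.
Lemma fl_addN : left_inverse fl0 fl_opp fl_add.
Proof. by elim/tcl_ind=> s; rewrite /fl_opp !flE; apply/tclE/TaddN. Qed.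

HB.instance Definition _ :=
  GRing.isZmodule.Build freeLie fl_addA fl_addC fl_add0 fl_addN.

Lemma fl_scaleA a b u : fl_scale a (fl_scale b u) = fl_scale (a * b) u.
Proof. by elim/tcl_ind: u => s; rewrite !flE; apply/tclE/TscaleA. Qed.
Lemma fl_scale1 : left_id 1 fl_scale.
Proof. by elim/tcl_ind=> s; rewrite !flE; apply/tclE/Tscale1. Qed.
Lemma fl_scaleDr : right_distributive fl_scale +%R.
Proof.
move=> a; elim/tcl_ind=> s; elim/tcl_ind=> t; rewrite -![_ + _]/(fl_add _ _).
by rewrite !flE; apply/tclE/TscaleDr.
Qed.
Lemma fl_scaleDl u : {morph fl_scale^~ u : a b / a + b}.
Proof.
elim/tcl_ind: u => s a b; rewrite -[RHS]/(fl_add _ _).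
by rewrite !flE; apply/tclE/TscaleDl.
Qed.

HB.instance Definition _ := GRing.Zmodule_isLmodule.Build K freeLie
  fl_scaleA fl_scale1 fl_scaleDr fl_scaleDl.

Lemma tclD s t : tcl (TAdd s t) = tcl s + tcl t.
Proof. exact/esym/fl_addE. Qed.
Lemma tclZ a s : tcl (TScale a s) = a *: tcl s.
Proof. exact/esym/fl_scaleE. Qed.

Lemma fl_linl (a : K) (x y z : freeLie) :
  fl_lie (a *: x + y) z = a *: fl_lie x z + fl_lie y z.
Proof.
elim/tcl_ind: x => x; elim/tcl_ind: y => y; elim/tcl_ind: z => z.
by rewrite -tclZ -tclD !flE -tclZ -tclD; apply/tclE/Tlinl.
Qed.
Lemma fl_linr (a : K) (x y z : freeLie) :
  fl_lie z (a *: x + y) = a *: fl_lie z x + fl_lie z y.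
Proof.
elim/tcl_ind: x => x; elim/tcl_ind: y => y; elim/tcl_ind: z => z.
by rewrite -tclZ -tclD !flE -tclZ -tclD; apply/tclE/Tlinr.
Qed.
Lemma fl_alt x : fl_lie x x = 0.
Proof. by elim/tcl_ind: x => x; rewrite flE; apply/tclE/Talt. Qed.
Lemma fl_jacobi x y z :
  fl_lie x (fl_lie y z) + fl_lie y (fl_lie z x) + fl_lie z (fl_lie x y) = 0.
Proof.
elim/tcl_ind: x => x; elim/tcl_ind: y => y; elim/tcl_ind: z => z.
by rewrite !flE -!tclD; apply/tclE/Tjacobi.
Qed.

HB.instance Definition _ :=
  Lmodule_isLieAlgebra.Build K freeLie fl_linl fl_linr fl_alt fl_jacobi.

Lemma tclL s t : tcl (TLie s t) = [lie tcl s, tcl t].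
Proof. exact/esym/fl_lieE. Qed.

Definition fgen (i : 'I_n) : freeLie := tcl (TGen i).

Lemma freeLie_ind (P : freeLie -> Prop) :
  (forall i, P (fgen i)) -> P 0 ->
  (forall u v, P u -> P v -> P (u + v)) -> (forall a u, P u -> P (a *: u)) ->
  (forall u v, P u -> P v -> P [lie u, v]) -> forall u, P u.
Proof.
move=> Pg P0 PD PZ PL; elim/tcl_ind; elim=> [i||s IHs t IHt|a s IHs|s IHs t IHt].
- exact: Pg.
- exact: P0.
- by rewrite tclD; apply: PD.
- by rewrite tclZ; apply: PZ.
- by rewrite tclL; apply: PL.
Qed.

Section Universal.
Variables (M : lieAlgType K) (f : 'I_n -> M).

Fixpoint teval (s : lterm) : M :=
  match s with
  | TGen i => f i
  | TZero => 0
  | TAdd s t => teval s + teval t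
  | TScale a s => a *: teval s
  | TLie s t => [lie teval s, teval t]
  end.

Lemma teval_eq s t : lteq s t -> teval s = teval t.
Proof.
elim=> //= {s t}.
- by move=> s t u _ -> _ ->.
- by move=> s t s' t' _ -> _ ->.
- by move=> a s s' _ ->.
- by move=> s t s' t' _ -> _ ->.
- by move=> *; rewrite addrA.
- by move=> *; rewrite addrC.
- by move=> *; rewrite add0r.
- by move=> *; rewrite scaleN1r addNr.
- by move=> *; rewrite scalerA.
- by move=> *; rewrite scale1r.
- by move=> *; rewrite scalerDr.
- by move=> *; rewrite scalerDl.
- by move=> *; rewrite lie_linearl.
- by move=> *; rewrite lie_linearr.
- by move=> *; rewrite lie_alt.
- by move=> *; rewrite lie_jacobi.
Qed.

(* With freeLie_hom_uniq, this is the universal property: freeLie is freely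
   generated by the elements fgen i. *)
Lemma freeLie_hom :
  exists2 F : freeLie -> M, lie_hom F & forall i, F (fgen i) = f i.
Proof.
pose F u := teval (trepr u).
have FE s : F (tcl s) = teval s by apply/teval_eq/trepr_tcl.
exists F; last by move=> i; rewrite FE.
split=> [a|]; elim/tcl_ind=> s; elim/tcl_ind=> t.
  by rewrite -tclZ -tclD !FE.
by rewrite -tclL !FE.
Qed.

Lemma freeLie_hom_uniq (F G : freeLie -> M) : lie_hom F -> lie_hom G ->
  (forall i, F (fgen i) = G (fgen i)) -> F =1 G.
Proof.
move=> hF hG e; elim/freeLie_ind=> //.
- by rewrite !lie_hom0.
- by move=> u v eu ev; rewrite !lie_homD // eu ev.
- by move=> a u eu; rewrite !lie_homZ // eu.
- by move=> u v eu ev; rewrite !lie_hom_lie // eu ev.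
Qed.
End Universal.

End FreeLie.

Arguments fgen {K n} i.

Section Tame.
Variables (K : fieldType) (n : nat).

Local Notation L := (freeLie K n).

Definition derL : {pred L} := gamma (lieT L) 2.
HB.instance Definition _ := LieIdeal.on derL.
Definition kerC : {pred L} := gamma derL 3.
HB.instance Definition _ := LieIdeal.on kerC.

(* C_n = L_n / gamma_3(L_n') *)
Definition Cn : Type := lie_quot kerC.
HB.instance Definition _ := LieAlgebra.on Cn.

Definition piC (u : L) : Cn := quo kerC u.

Definition qgen (i : 'I_n) : Cn := piC (fgen i).

Lemma hom_gamma (M N : lieAlgType K) (f : M -> N) (A : lieIdeal M)
    (B : lieIdeal N) c :
  lie_hom f -> (forall x, x \in A -> f x \in B) ->
  forall x, x \in gamma A c -> f x \in gamma B c.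
Proof.
move=> hf fAB; rewrite /gamma; elim: c.-1 => [|k IH] //= x /commpP.
elim=> {x} [|a u v _ IHu _ IHv|u v Au Av].
- by rewrite lie_hom0 //; exact/commpP/CommSpan0.
- by rewrite hf.1; apply/commpP/CommSpanD; apply/commpP.
- by rewrite hf.2; apply: commp_lie; [apply: IH | apply: fAB].
Qed.

Lemma Cn_ind (P : Cn -> Prop) :
  (forall i, P (qgen i)) -> P 0 ->
  (forall u v, P u -> P v -> P (u + v)) -> (forall a u, P u -> P (a *: u)) ->
  (forall u v, P u -> P v -> P [lie u, v]) -> forall u, P u.
Proof.
move=> Pq P0 PD PZ PL; elim/quo_ind=> x; elim/freeLie_ind: x => //.
- by rewrite quo0.
- by move=> u v Pu Pv; rewrite quoD; apply: PD.
- by move=> a u Pu; rewrite quoZ; apply: PZ.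
- by move=> u v Pu Pv; rewrite (quo_hom kerC).2; apply: PL.
Qed.

Lemma Cn_hom_uniq (M : lieAlgType K) (F G : Cn -> M) :
  lie_hom F -> lie_hom G -> (forall i, F (qgen i) = G (qgen i)) -> F =1 G.
Proof.
move=> hF hG e; elim/Cn_ind=> //.
- by rewrite !lie_hom0.
- by move=> u v eu ev; rewrite !lie_homD // eu ev.
- by move=> a u eu; rewrite !lie_homZ // eu.
- by move=> u v eu ev; rewrite !lie_hom_lie // eu ev.
Qed.

Definition derC : {pred Cn} := gamma (lieT Cn) 2.
HB.instance Definition _ := LieIdeal.on derC.

Lemma derC_lie (u v : Cn) : [lie u, v] \in derC.
Proof. exact: commp_lie. Qed.

Lemma Cn_gamma3 (u : Cn) : u \in gamma derC 3 -> u = 0.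
Proof.
have lift (A : {pred L}) (B : {pred Cn}) k :
    (forall v, v \in B -> exists2 x, x \in A & piC x = v) ->
    forall v, v \in gamma B k -> exists2 x, x \in gamma A k & piC x = v.
  move=> AB; rewrite /gamma; elim: k.-1 => [|j IH] //= v /commpP.
  elim=> {v} [|a v w _ [x Ax <-] _ [y Ay <-]|v w /IH[x Ax <-] /AB[y Ay <-]].
  - by exists 0; [exact/commpP/CommSpan0 | exact: quo0].
  - exists (a *: x + y); last exact: (quo_hom kerC).1.
    by apply/commpP/CommSpanD; apply/commpP.
  - by exists [lie x, y]; [exact: commp_lie | exact: (quo_hom kerC).2].
have liftT v : v \in lieT Cn -> exists2 x, x \in lieT L & piC x = v.
  by move=> _; exists (quo_repr v); rewrite // /piC quoK.
by case/(lift derL derC 3 (lift _ _ 2 liftT)) => x Kx <-; apply/quo_eq0.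
Qed.

Section Elementary.
Variable i0 : 'I_n.

Let hom_add (w : Cn) :
  exists2 phi : Cn -> Cn, lie_hom phi &
    phi (qgen i0) = qgen i0 + w /\ forall i, i != i0 -> phi (qgen i) = qgen i.
Proof.
have [F hF eF] := freeLie_hom
  (fun i => if i == i0 then qgen i0 + w else qgen i : Cn).
have F0 x : x \in kerC -> F x = 0.
  move=> Kx; apply: Cn_gamma3; move: x Kx.
  by apply: hom_gamma => // x; apply: hom_gamma.
have [phi hphi ephi] := lie_hom_lift hF F0.
exists phi => //; split=> [|i /negbTE ni]; rewrite [LHS]ephi eF ?eqxx //.
by rewrite ni.
Qed.

Let hom_fix (w : Cn) (phi : Cn -> Cn) : w \in gamma derC 2 -> lie_hom phi ->
  phi (qgen i0) = qgen i0 + w -> (forall i, i != i0 -> phi (qgen i) = qgen i) ->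
  forall u, u \in gamma derC 2 -> phi u = u.
Proof.
move=> Dw hphi e0 ei.
have near u : phi u - u \in gamma derC 2.
  elim/Cn_ind: u => [i||u v Du Dv|a u Du|u v Du Dv].
  - have [->|ni] := eqVneq i i0; first by rewrite e0 addrAC subrr add0r.
    by rewrite ei // subrr rpred0.
  - by rewrite lie_hom0 // subr0 rpred0.
  - by rewrite lie_homD // opprD addrACA rpredD.
  - by rewrite lie_homZ // -scalerBr; apply: lie_ideal_scale.
  - rewrite lie_hom_lie // -(subrKA [lie u, phi v]) -lieBl -lieBr.
    by apply: rpredD; [apply: lie_ideall | apply: lie_idealr].
move=> u /commpP; elim=> {u} [|a u v _ eu _ ev|u v Du Dv].
- exact: lie_hom0.
- by rewrite hphi.1 eu ev.
apply/eqP; rewrite -subr_eq0; apply/eqP/Cn_gamma3.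
rewrite lie_hom_lie // -(subrKA [lie u, phi v]) -lieBl -lieBr rpredD //.
  have phiv : phi v \in derC.
    exact: (hom_gamma (A := lieT Cn) (B := lieT Cn) (c := 2) hphi).
  exact: (@commp_lie _ _ (gamma derC 2) derC).
rewrite lieC rpredN; exact: (@commp_lie _ _ (gamma derC 2) derC).
Qed.

Lemma Cn_elementary (w : Cn) : w \in gamma derC 2 ->
  exists2 phi : Cn -> Cn, lie_aut phi &
    phi (qgen i0) = qgen i0 + w /\ forall i, i != i0 -> phi (qgen i) = qgen i.
Proof.
move=> Dw; have [phi hphi [e0 ei]] := hom_add w.
have [psi hpsi [f0 fi]] := hom_add (- w).
have fixphi := hom_fix Dw hphi e0 ei.
have DNw : - w \in gamma derC 2 by rewrite rpredN.
have fixpsi := hom_fix DNw hpsi f0 fi.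
exists phi => //; split=> //.
have hcomp (f g : Cn -> Cn) : lie_hom f -> lie_hom g -> lie_hom (f \o g).
  move=> [fl fL] [gl gL].
  by split=> [a x y|x y] /=; rewrite ?gl ?fl ?gL ?fL.
have hid : lie_hom (@id Cn) by [].
exists psi; apply: Cn_hom_uniq => //; try exact: hcomp; move=> i /=.
  have [->|ni] := eqVneq i i0; last by rewrite ei // fi.
  by rewrite e0 lie_homD // f0 fixpsi // subrK.
have [->|ni] := eqVneq i i0; last by rewrite fi // ei.
by rewrite f0 lie_homD // e0 fixphi // addrK.
Qed.
End Elementary.

(* phi lies in the image of Aut(L_n) -> Aut(C_n): it is the map induced on the
   quotient C_n by an automorphism psi of L_n. *)
Definition tame (phi : Cn -> Cn) : Prop :=
  exists2 psi : L -> L, lie_aut psi & forall u, phi (piC u) = piC (psi u).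

End Tame.

(* The generators x_1, ..., x_4 are indexed by the ordinals 0, ..., 3. *)
Definition ix1 n (hn : (4 <= n)%N) : 'I_n := widen_ord hn (@Ordinal 4 0 isT).
Definition ix2 n (hn : (4 <= n)%N) : 'I_n := widen_ord hn (@Ordinal 4 1 isT).
Definition ix3 n (hn : (4 <= n)%N) : 'I_n := widen_ord hn (@Ordinal 4 2 isT).
Definition ix4 n (hn : (4 <= n)%N) : 'I_n := widen_ord hn (@Ordinal 4 3 isT).

(* phi_kappa exists; it is unique by Cn_hom_uniq. *)
Lemma phi_kappa_exists (K : fieldType) n (hn : (4 <= n)%N) (kappa : nat) :
  let q1 := qgen K (ix1 hn) in let q2 := qgen K (ix2 hn) in
  let q3 := qgen K (ix3 hn) in let q4 := qgen K (ix4 hn) in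
  exists2 phi : Cn K n -> Cn K n, lie_aut phi &
    phi q1 = q1 + [lie lie_iter (kappa - 1) [lie q1, q2] q1, [lie q3, q4]] /\
    forall i, i != ix1 hn -> phi (qgen K i) = qgen K i.
Proof.
apply: Cn_elementary; apply: commp_lie; last exact: derC_lie.
by case: (kappa - 1)%N => [|m] /=; exact: derC_lie.
Qed.

(* Main.v *)
Require Import Defs.
From HB Require Import structures.
From mathcomp Require Import all_boot all_order all_fingroup all_algebra.
From mathcomp Require Import ring.

Set Implicit Arguments.
Unset Strict Implicit.
Unset Printing Implicit Defensive.

Import GRing.Theory.
Local Open Scope ring_scope.

(**
Suppose that an automorphism psi of L_n induces phi_kappa on C_n.  Its Fox
Jacobian, the matrix of the Fox derivatives of the psi(x_i), is then invertible
over the universal enveloping algebra of L_n, the inverse being read off from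
psi^-1 by the chain rule.  A representation rho of L_n by p x p matrices over
a commutative ring R turns it into an invertible matrix of size n p over R; for
R = K[X] its determinant is a nonzero constant.

The representation [loop_rep] contradicts this.  It acts by 2 x 2 matrices:
x_1 goes to 1, x_2, x_3, x_4 go to X E_12, X E_22, X E_21, and the other
generators go to 0.  All values of rho are scalar modulo X, so rho(L_n') is
divisible by X^2 and the Fox derivatives of gamma_3(L_n') are divisible by X^4:
passing from C_n to L_n changes the Jacobian by a multiple of X^4 only
([fox_kerC]).  The Jacobian is thus 1 + N with N divisible by X^2, and its
determinant is 1 + tr N modulo X^4 ([det_add1_modsq]).  The only contribution
to tr N below X^4 is the derivative by x_1 of the commutator that phi_kappa
adds to q_1.  Since x_1 acts as a scalar, the element [x_1, x_2, x_1, ..., x_1]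
acts as 0, while its derivative by x_1 is X E_12 up to sign; so the trace is
that of rho([x_3, x_4]) (X E_12) = (X^2 E_21) (X E_12), which is X^3, up to
sign ([fox_trace_phi]).  Hence the determinant is 1 + X^3 or 1 - X^3 modulo
X^4, and is not constant.

The enveloping algebra itself does not appear: a derivation from L_n to a
module W over rho is the same as a Lie homomorphism from L_n to the semidirect
product of gl_p with W that lifts rho, and such homomorphisms exist because
L_n is free.
*)

(** * The semidirect product of gl_p(R) with p x m matrices *)

Lemma cyclic_sum_cancel (V : zmodType) (a b c d e f : V) :
  (a - b - (c - d)) + (c - e - (f - b)) + (f - d - (a - e)) = 0.
Proof.
rewrite !opprB !addrA.
(* Pair each letter with its opposite. *)
rewrite (ACl ((1*12)*(7*2)*(3*10)*(5*4)*(11*6)*(9*8)))/=.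
by rewrite !subrr !addr0.
Qed.

Section AffineLie.
Variables (K : fieldType) (R : comAlgType K) (p m : nat).

(** A pair (A, X) stands for the block matrix (A X; 0 0), under the commutator
    bracket.  Scalars are taken in K, not in R, because this is to be the target
    of homomorphisms from a free Lie algebra over K. *)
Definition affLie : Type := ('M[R]_p * 'M[R]_(p, m))%type.

HB.instance Definition _ := GRing.Zmodule.on affLie.

Implicit Types u v w : affLie.

Definition aff_scale (a : K) u : affLie := (a%:A *: u.1, a%:A *: u.2).

Lemma aff_scaleA a b u : aff_scale a (aff_scale b u) = aff_scale (a * b) u.
Proof. by rewrite /aff_scale /= !scalerA -scalerAl mul1r scalerA. Qed.
Lemma aff_scale1 : left_id 1 aff_scale.
Proof. by case=> A X; rewrite /aff_scale /= !scale1r. Qed.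
Lemma aff_scaleDr : right_distributive aff_scale +%R.
Proof. by move=> a u v; rewrite /aff_scale /= !scalerDr. Qed.
Lemma aff_scaleDl u : {morph aff_scale^~ u : a b / a + b}.
Proof. by move=> a b; rewrite /aff_scale /= !scalerDl. Qed.

HB.instance Definition _ := GRing.Zmodule_isLmodule.Build K affLie
  aff_scaleA aff_scale1 aff_scaleDr aff_scaleDl.

Definition aff_lie u v : affLie :=
  (u.1 *m v.1 - v.1 *m u.1, u.1 *m v.2 - v.1 *m u.2).

Lemma aff_alt u : aff_lie u u = 0.
Proof. by rewrite /aff_lie !subrr. Qed.

Lemma aff_linr a u v w :
  aff_lie w (a *: u + v) = a *: aff_lie w u + aff_lie w v.
Proof.
congr (_, _) => /=; rewrite mulmxDr mulmxDl -scalemxAr -scalemxAl scalerBr.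
  by rewrite opprD addrACA.
by rewrite opprD addrACA.
Qed.

Lemma aff_linl a u v w :
  aff_lie (a *: u + v) w = a *: aff_lie u w + aff_lie v w.
Proof.
have opp x y : aff_lie x y = - aff_lie y x by congr (_, _); rewrite /= opprB.
by rewrite opp aff_linr opprD -scalerN -!opp.
Qed.

Lemma aff_jacobi u v w :
  aff_lie u (aff_lie v w) + aff_lie v (aff_lie w u) + aff_lie w (aff_lie u v)
  = 0.
Proof.
congr (_, _) => /=; rewrite !(mulmxBl, mulmxBr) !mulmxA;
  exact: cyclic_sum_cancel.
Qed.

HB.instance Definition _ := Lmodule_isLieAlgebra.Build K affLie
  aff_linl aff_linr aff_alt aff_jacobi.

End AffineLie.

Lemma aff_map_hom (K : fieldType) (R : comAlgType K) p m k (X : 'M[R]_(m, k)) :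
  lie_hom (fun u : affLie R p m => (u.1, u.2 *m X) : affLie R p k).
Proof.
split=> [a u v|u v]; congr (_, _) => /=.
  by rewrite mulmxDl -scalemxAl.
by rewrite mulmxBl !mulmxA.
Qed.

(** * Fox derivatives and the chain rule *)

Section Fox.
Variables (K : fieldType) (R : comAlgType K) (n p : nat).
Local Notation L := (freeLie K n).

Definition fox_index : finType := ('I_n * 'I_p)%type.

Definition row_block k (i : 'I_n) (X : 'M[R]_(#|fox_index|, k)) :
    'M[R]_(p, k) :=
  rowsub (fun a => enum_rank (i, a)) X.

Definition stack_blocks k (W : 'I_n -> 'M[R]_(p, k)) :
    'M[R]_(#|fox_index|, k) :=
  \matrix_(r, c) W (enum_val r).1 (enum_val r).2 c.

Lemma stack_blocksK k (W : 'I_n -> 'M[R]_(p, k)) i :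
  row_block i (stack_blocks W) = W i.
Proof. by apply/matrixP=> a c; rewrite !mxE enum_rankK. Qed.

Lemma row_block_inj k (X Y : 'M[R]_(#|fox_index|, k)) :
  (forall i, row_block i X = row_block i Y) -> X = Y.
Proof.
move=> e; apply/matrixP=> r c.
have /matrixP/(_ (enum_val r).2 c) := e (enum_val r).1.
by rewrite !mxE -surjective_pairing enum_valK.
Qed.

Lemma row_block_mul k l (X : 'M[R]_(#|fox_index|, k)) (Y : 'M[R]_(k, l)) i :
  row_block i (X *m Y) = row_block i X *m Y.
Proof. by rewrite /row_block mul_rowsub_mx. Qed.

(** The second component of such an F collects all Fox derivatives with respect
    to the representation given by the first: its i-th column block is the
    derivation that sends x_i to 1 and the other generators to 0. *)
Definition fox_hom (F : L -> affLie R p #|fox_index|) : Prop :=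
  lie_hom F /\ forall i, (F (fgen i)).2 = row_block i 1%:M.

Lemma fox_exists (rho : 'I_n -> 'M[R]_p) :
  exists2 F : L -> affLie R p #|fox_index|, fox_hom F &
    forall i, (F (fgen i)).1 = rho i.
Proof.
have [F hF eF] := freeLie_hom
  (fun i => (rho i, row_block i 1%:M) : affLie R p #|fox_index|).
by exists F; [split=> // i|move=> i]; rewrite eF.
Qed.

(** Let D, D' be the Fox derivatives for rho and rho \o psi, and J the Jacobian
    of psi for rho.  Then u |-> D(psi(u)) and u |-> D'(u) J are derivations with
    respect to the same representation rho \o psi and agree on the generators,
    hence everywhere.  At u = psi^-1(x_i) this exhibits a left inverse of J. *)
Lemma fox_jacobian_inv F (psi : L -> L) : fox_hom F -> lie_aut psi ->
  exists J' : 'M[R]_#|fox_index|,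
    J' *m stack_blocks (fun i => (F (psi (fgen i))).2) = 1%:M.
Proof.
move=> [hF F1] [hpsi [psi' _ psiK]]; set J := stack_blocks _.
have [G [hG G1] Grho] := fox_exists (fun i => (F (psi (fgen i))).1).
have chain u : F (psi u) = ((G u).1, (G u).2 *m J).
  have hFpsi : lie_hom (F \o psi).
    by split=> [a x y|x y] /=; rewrite ?hpsi.1 ?hF.1 ?hpsi.2 ?hF.2.
  have hGJ :
      lie_hom (fun u => ((G u).1, (G u).2 *m J) : affLie R p #|fox_index|).
    have hJ := @aff_map_hom K R p _ _ J.
    by split=> [a x y|x y]; rewrite ?hG.1 ?hG.2 ?hJ.1 ?hJ.2.
  apply: (freeLie_hom_uniq hFpsi hGJ) => i /=.
  rewrite Grho G1 -row_block_mul mul1mx stack_blocksK.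
  exact: surjective_pairing.
exists (stack_blocks (fun i => (G (psi' (fgen i))).2)).
apply: row_block_inj => i.
by rewrite row_block_mul stack_blocksK -F1 -[in RHS](psiK (fgen i)) chain.
Qed.

End Fox.

(** * Matrices of polynomials with a common divisor *)

Section Divisibility.
Variables (K : fieldType).
Implicit Types d e : {poly K}.

Definition mxdvd d m n (A : 'M[{poly K}]_(m, n)) : Prop :=
  forall i j, d %| A i j.

Lemma mxdvdD d m n (A B : 'M[{poly K}]_(m, n)) :
  mxdvd d A -> mxdvd d B -> mxdvd d (A + B).
Proof. by move=> dA dB i j; rewrite mxE dvdp_add. Qed.
Lemma mxdvdN d m n (A : 'M[{poly K}]_(m, n)) : mxdvd d A -> mxdvd d (- A).
Proof. by move=> dA i j; rewrite mxE dvdpNr. Qed.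
Lemma mxdvdB d m n (A B : 'M[{poly K}]_(m, n)) :
  mxdvd d A -> mxdvd d B -> mxdvd d (A - B).
Proof. by move=> dA /mxdvdN; apply: mxdvdD. Qed.
Lemma mxdvdZ d c m n (A : 'M[{poly K}]_(m, n)) : mxdvd d A -> mxdvd d (c *: A).
Proof. by move=> dA i j; rewrite mxE dvdp_mull. Qed.
Lemma mxdvd0 d m n : mxdvd d (0 : 'M_(m, n)).
Proof. by move=> i j; rewrite mxE dvdp0. Qed.
Lemma dvdp_sumr d (I : Type) (r : seq I) (P : pred I) (E : I -> {poly K}) :
  (forall i, P i -> d %| E i) -> d %| \sum_(i <- r | P i) E i.
Proof. by move=> dE; elim/big_ind: _ => // x y; exact: dvdp_add. Qed.
Lemma mxdvdM d e m n k (A : 'M[{poly K}]_(m, n)) (B : 'M_(n, k)) :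
  mxdvd d A -> mxdvd e B -> mxdvd (d * e) (A *m B).
Proof.
by move=> dA eB i j; rewrite mxE; apply: dvdp_sumr => l _; apply: dvdp_mul.
Qed.
Lemma mxdvdMl d m n k (A : 'M[{poly K}]_(m, n)) (B : 'M_(n, k)) :
  mxdvd d A -> mxdvd d (A *m B).
Proof.
by move=> dA i j; rewrite mxE; apply: dvdp_sumr => l _; apply: dvdp_mulr.
Qed.

(** In the Leibniz formula, a permutation other than 1 moves at least two points
    and thus contributes a multiple of two off-diagonal entries of N. *)
Lemma det_add1_modsq d m (N : 'M[{poly K}]_m) :
  mxdvd d N -> d ^+ 2 %| \det (1%:M + N) - (1 + \tr N).
Proof.
move=> dN; rewrite /determinant (bigD1 (1%g : 'S_m)) //= addrAC.
apply: dvdp_add.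
  rewrite odd_perm1 mul1r.
  under eq_bigr => i _ do rewrite perm1 !mxE eqxx.
  rewrite /mxtrace.
  suff [] : d %| \sum_i N i i /\
     d ^+ 2 %| \prod_i (1 + N i i) - (1 + \sum_i N i i) by [].
  elim/big_rec2: _ => [|i s q _ [ds dq]]; first by rewrite addr0 subrr !dvdp0.
  split; first exact: dvdp_add.
  have -> : (1 + N i i) * q - (1 + (N i i + s)) =
      (1 + N i i) * (q - (1 + s)) + N i i * s.
    by ring.
  by apply: dvdp_add; [apply: dvdp_mull | rewrite expr2; apply: dvdp_mul].
apply: dvdp_sumr => s s1; apply: dvdp_mull.
have [i si] : exists i, s i != i.
  apply/existsP; apply: contraR s1; rewrite negb_exists => /forallP s1.
  by apply/eqP/permP=> i; rewrite perm1; apply/eqP; rewrite -[_ == _]negbK.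
have ssi : s (s i) != s i by rewrite (inj_eq perm_inj).
rewrite (bigD1 i) //= (bigD1 (s i)) //= mulrA; apply: dvdp_mulr.
rewrite expr2.
by apply: dvdp_mul; rewrite !mxE eq_sym ?(negbTE si) ?(negbTE ssi) add0r.
Qed.

End Divisibility.

Lemma scalar_mx0 (R : pzRingType) p : 0%:M = 0 :> 'M[R]_p.
Proof. exact: raddf0. Qed.

(** Scalars drop out of commutators, so that the bracket of two matrices which
    are scalar modulo d is divisible by d ^+ 2. *)
Lemma commutator_sub_scalar (R : comNzRingType) p (A B : 'M[R]_p) a b :
  A *m B - B *m A =
  (A - a%:M) *m (B - b%:M) - (B - b%:M) *m (A - a%:M).
Proof.
rewrite !(mulmxBl, mulmxBr) !mul_scalar_mx !mul_mx_scalar.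
rewrite !scale_scalar_mx [b * a]mulrC !opprB !addrA.
rewrite [RHS](ACl (1*8*(2*5)*(3*6)*(4*7)))/=.
by rewrite !addNr subrr !addr0.
Qed.

(** * Divisibility along the lower central series of the derived algebra *)

Section Filtration.
Variables (K : fieldType) (n p m : nat) (d : {poly K}).
Variable F : freeLie K n -> affLie {poly K} p m.
Hypothesis homF : lie_hom F.
Hypothesis near_scalar_gen :
  forall i, exists c : {poly K}, mxdvd d ((F (fgen i)).1 - c%:M).

Lemma near_scalar u : exists c : {poly K}, mxdvd d ((F u).1 - c%:M).
Proof.
elim/freeLie_ind: u => [//||u v [a da] [b db]|a u [b db]|u v [a da] [b db]].
- by exists 0; rewrite (lie_hom0 homF) scalar_mx0 subrr; apply: mxdvd0.
- exists (a + b); rewrite (lie_homD homF) [(a + b)%:M]raddfD opprD addrACA.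
  exact: mxdvdD.
- exists (a%:A * b); rewrite (lie_homZ homF) -scale_scalar_mx /= -scalerBr.
  exact: mxdvdZ.
exists 0; rewrite (lie_hom_lie homF) scalar_mx0 subr0 /=.
by rewrite (commutator_sub_scalar _ _ a b); apply: mxdvdB; apply: mxdvdMl.
Qed.

Lemma rep_derL u : u \in @derL K n -> mxdvd (d ^+ 2) (F u).1.
Proof.
move=> /commpP; elim=> {u} [|a u v _ IHu _ IHv|u v _ _].
- by rewrite (lie_hom0 homF); apply: mxdvd0.
- by rewrite homF.1; apply: mxdvdD => //; apply: mxdvdZ.
have [a da] := near_scalar u; have [b db] := near_scalar v.
rewrite (lie_hom_lie homF) /=.
rewrite (commutator_sub_scalar _ _ a b) expr2.
by apply: mxdvdB; apply: mxdvdM.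
Qed.

(** A Fox derivative of [u, v] is rho(u) D(v) - rho(v) D(u): each bracket of
    elements of L' gains a factor d ^+ 2, but the derivatives of elements of L'
    itself have no divisibility to start with. *)
Lemma fox_gamma2 u : u \in gamma (@derL K n) 2 ->
  mxdvd (d ^+ 4) (F u).1 /\ mxdvd (d ^+ 2) (F u).2.
Proof.
move=> /commpP; elim=> {u} [|a u v _ [u1 u2] _ [v1 v2]|u v Du Dv].
- by rewrite (lie_hom0 homF); split; apply: mxdvd0.
- by rewrite homF.1; split; apply: mxdvdD => //; apply: mxdvdZ.
have u1 := rep_derL Du; have v1 := rep_derL Dv.
rewrite (lie_hom_lie homF) /= (exprM d 2 2) expr2.
by split; apply: mxdvdB; do ?[exact: mxdvdMl | exact: mxdvdM].
Qed.

Lemma fox_kerC u : u \in @kerC K n -> mxdvd (d ^+ 4) (F u).2.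
Proof.
move=> /commpP; elim=> {u} [|a u v _ IHu _ IHv|u v Du Dv].
- by rewrite (lie_hom0 homF); apply: mxdvd0.
- by rewrite homF.1; apply: mxdvdD => //; apply: mxdvdZ.
have [u1 u2] := fox_gamma2 Du; have v1 := rep_derL Dv.
rewrite (lie_hom_lie homF) /=; apply: mxdvdB; first exact: mxdvdMl.
by rewrite (exprM d 2 2) expr2; apply: mxdvdM.
Qed.
End Filtration.

(** * The trace of a Jacobian *)

Section Trace.
Variables (K : fieldType) (R : comAlgType K) (n p : nat).

Definition col_block k (i : 'I_n) (X : 'M[R]_(k, #|fox_index n p|)) :
    'M[R]_(k, p) :=
  colsub (fun a => enum_rank (i, a)) X.

Lemma col_blockD k i : {morph @col_block k i : X Y / X + Y}.
Proof. by move=> X Y; apply/matrixP=> a c; rewrite !mxE. Qed.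
Lemma col_blockN k i : {morph @col_block k i : X / - X}.
Proof. by move=> X; apply/matrixP=> a c; rewrite !mxE. Qed.
Lemma col_block_mul k l i (A : 'M[R]_(l, k)) (X : 'M_(k, _)) :
  col_block i (A *m X) = A *m col_block i X.
Proof.
by apply/matrixP=> a c; rewrite !mxE; apply: eq_bigr => b _; rewrite mxE.
Qed.

Lemma col_row_block1 i j : col_block i (row_block j 1%:M) = (j == i)%:R%:M.
Proof.
apply/matrixP=> a b; rewrite !mxE (inj_eq enum_rank_inj) xpair_eqE.
by case: eqP; rewrite ?mul0rn // mulr1n.
Qed.

Lemma mxtrace_stack (W : 'I_n -> 'M[R]_(p, #|fox_index n p|)) :
  \tr (stack_blocks W) = \sum_i \tr (col_block i (W i)).
Proof.
rewrite /mxtrace pair_bigA.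
rewrite (reindex _ (onW_bij _ (@enum_val_bij (fox_index n p)))) /=.
by apply: eq_bigr => r _; rewrite !mxE -surjective_pairing enum_valK.
Qed.

End Trace.

(** * The representation that detects the automorphisms *)

Section Representation.
Variables (K : fieldType) (n : nat) (hn : (4 <= n)%N).

(** The powers of X record the degree in x_2, x_3, x_4; the three matrix units
    are chosen with tr (E_12 [E_22, E_21]) = 1. *)
Definition loop_rep (i : 'I_n) : 'M[{poly K}]_2 :=
  if i == ix1 hn then 1%:M else if i == ix2 hn then 'X *: delta_mx 0 1
  else if i == ix3 hn then 'X *: delta_mx 1 1
  else if i == ix4 hn then 'X *: delta_mx 1 0 else 0.

Lemma loop_rep_near_scalar i :
  exists c : {poly K}, mxdvd 'X (loop_rep i - c%:M).
Proof.
rewrite /loop_rep; case: ifP => _.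
  by exists 1; rewrite subrr; apply: mxdvd0.
have dvdX k l : mxdvd 'X ('X *: delta_mx k l : 'M[{poly K}]_2).
  by move=> a b; rewrite mxE dvdp_mulr.
by exists 0; rewrite scalar_mx0 subr0; do !case: ifP => _ //; apply: mxdvd0.
Qed.

Variable F : freeLie K n -> affLie {poly K} 2 #|fox_index n 2|.
Hypothesis foxF : fox_hom F.
Hypothesis F_rep : forall i, (F (fgen i)).1 = loop_rep i.

Let x1 := fgen (ix1 hn) : freeLie K n.
Let x2 := fgen (ix2 hn) : freeLie K n.
Let x3 := fgen (ix3 hn) : freeLie K n.
Let x4 := fgen (ix4 hn) : freeLie K n.

(** As x_1 acts as the identity, bracketing with it kills the action of u and
    changes the sign of its derivative. *)
Lemma fox_lie_iter k :
  let u := lie_iter k [lie x1, x2] x1 in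
  (F u).1 = 0 /\
  col_block (ix1 hn) (F u).2 = (- 1) ^+ k.+1 *: ('X *: delta_mx 0 1).
Proof.
have [hF F1] := foxF; elim: k => [|k [IH1 IH2]] /=.
  rewrite (lie_hom_lie hF) /= !F_rep /loop_rep !eqxx /= mul1mx mulmx1 subrr.
  split=> //; rewrite mul1mx col_blockD col_blockN col_block_mul !F1.
  rewrite !col_row_block1 eqxx scalar_mx0 mulmx1 sub0r.
  by rewrite expr1 scaleN1r.
rewrite (lie_hom_lie hF) /= IH1 !mul0mx mulmx0 subrr F_rep /loop_rep eqxx.
split=> //; rewrite sub0r mul1mx col_blockN IH2.
by rewrite -scaleNr [in RHS]exprS mulN1r.
Qed.

Lemma fox_lie34 : (F [lie x3, x4]).1 = 'X^2 *: delta_mx 1 0.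
Proof.
rewrite (lie_hom_lie foxF.1) /= !F_rep /loop_rep !eqxx /=.
rewrite -!scalemxAl -!scalemxAr !scalerA mul_delta_mx mul_delta_mx_0 //.
by rewrite !scaler0 subr0 expr2.
Qed.

Lemma fox_trace_phi k :
  let w := [lie lie_iter k [lie x1, x2] x1, [lie x3, x4]] in
  \tr (col_block (ix1 hn) (F w).2) = (- 1) ^+ k * 'X^3.
Proof.
have [u1 u2] := fox_lie_iter k.
rewrite /= (lie_hom_lie foxF.1) /= u1 mul0mx sub0r col_blockN col_block_mul u2.
rewrite fox_lie34 -scalemxAl -!scalemxAr mul_delta_mx !scalerA.
rewrite linearN linearZ /= /mxtrace big_ord_recl big_ord1 !mxE /=.
rewrite (exprS _ k).
by ring.
Qed.

(** Were there such a psi, its Jacobian would have constant determinant, while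
    the coefficient of X^3 in that determinant is 1 or -1. *)
Lemma no_free_lift k (psi : freeLie K n -> freeLie K n) :
  let w := [lie lie_iter k [lie x1, x2] x1, [lie x3, x4]] in
  lie_aut psi ->
  ~ forall i, psi (fgen i) - fgen i - (if i == ix1 hn then w else 0)
              \in @kerC K n.
Proof.
move=> w autpsi ker; have [hF F1] := foxF.
have near i : exists c : {poly K}, mxdvd 'X ((F (fgen i)).1 - c%:M).
  by rewrite F_rep; apply: loop_rep_near_scalar.
have kerX4 := fox_kerC hF near.
pose r i := psi (fgen i) - fgen i - (if i == ix1 hn then w else 0).
pose N i := (F (psi (fgen i) - fgen i)).2.
have NE i : N i = (F (r i)).2 + (if i == ix1 hn then (F w).2 else 0).
  rewrite /N -[in LHS](subrK (if i == ix1 hn then w else 0) (_ - _)).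
  by rewrite (lie_homD hF) /= /r; case: ifP => // _; rewrite (lie_hom0 hF).
have JE : stack_blocks (fun i => (F (psi (fgen i))).2) = 1%:M + stack_blocks N.
  apply: row_block_inj => i; rewrite stack_blocksK.
  have -> : row_block i (1%:M + stack_blocks N) =
      row_block i 1%:M + row_block i (stack_blocks N).
    by apply/matrixP=> a c; rewrite !mxE.
  by rewrite stack_blocksK /N (lie_homB hF) /= F1 addrC subrK.
have w2 : mxdvd ('X ^+ 2) (F w).2.
  apply: (fox_gamma2 hF near _).2; apply: commp_lie; last exact: commp_lie.
  by rewrite /=; case: (k) => [|j]; apply: commp_lie.
have dN : mxdvd ('X ^+ 2) (stack_blocks N).
  move=> a c; rewrite mxE NE mxE dvdp_add //.
    by apply: dvdp_trans (kerX4 _ (ker _) _ _); rewrite dvdp_exp2l.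
  by case: ifP => _; [apply: w2 | rewrite mxE dvdp0].
have trN : 'X^4 %| \tr (stack_blocks N) - (- 1) ^+ k * 'X^3.
  rewrite mxtrace_stack -(fox_trace_phi k) (bigD1 (ix1 hn)) //=.
  rewrite NE eqxx col_blockD raddfD /= addrAC addrK; apply: dvdp_add.
    by apply: dvdp_sumr => a _; rewrite mxE; apply: kerX4; apply: ker.
  apply: dvdp_sumr => i /negbTE ni; rewrite NE ni addr0.
  by apply: dvdp_sumr => a _; rewrite mxE; apply: kerX4; apply: ker.
have [J' /(congr1 determinant)] := fox_jacobian_inv foxF autpsi.
rewrite det_mulmx det1 JE; set D := \det (_ + _) => D1.
have [c Dc] : exists c, D = c%:P.
  exists D`_0; apply: size1_polyC.
  have : D %| 1 by rewrite -D1; apply: dvdp_mulIr.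
  by rewrite dvdp1 => /eqP ->.
have : 'X^4 %| D - (1 + (- 1) ^+ k * 'X^3).
  rewrite -[D](subrK (1 + \tr (stack_blocks N))) -addrA dvdp_add //.
    by have := det_add1_modsq dN; rewrite -exprM.
  by rewrite opprD addrACA subrr add0r.
case/dvdpP => q /(congr1 (fun s : {poly K} => s`_3)).
have -> : (- 1) ^+ k = ((- 1) ^+ k)%:P :> {poly K} by rewrite rmorphXn rmorphN1.
rewrite coefMXn Dc !coefB coefD coefC coef1 coefCM /=.
rewrite coefXn mulr1 !add0r => /eqP.
by rewrite oppr_eq0 signr_eq0.
Qed.

End Representation.

Theorem proposition4p1 (K : fieldType) (charK : [pchar K] =i pred0)
    (n : nat) (hn : (4 <= n)%N) (kappa : nat) (hkappa : (0 < kappa)%N)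
    (phi : Cn K n -> Cn K n) (autphi : lie_aut phi) :
  let q1 := qgen K (ix1 hn) in let q2 := qgen K (ix2 hn) in
  let q3 := qgen K (ix3 hn) in let q4 := qgen K (ix4 hn) in
  phi q1 = q1 + [lie lie_iter (kappa - 1) [lie q1, q2] q1, [lie q3, q4]] ->
  (forall i, i != ix1 hn -> phi (qgen K i) = qgen K i) ->
  ~ tame phi.
Proof.
move=> q1 q2 q3 q4 phi1 phi_fix [psi autpsi psiE].
have [F foxF F_rep] := fox_exists (loop_rep K hn).
apply: (no_free_lift foxF F_rep (k := kappa - 1) autpsi) => i.
have hpi := quo_hom (@kerC K n).
apply/(quo_eq0 (@kerC K n)).
rewrite !(lie_homB hpi) -[quo _ (psi _)]psiE -[quo _ (fgen i)]/(qgen K i).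
rewrite -[piC _]/(qgen K i); case: eqP => [->|/eqP ni].
  rewrite phi1 [X in X - _]addrAC subrr add0r.
  by rewrite !(lie_hom_lie hpi, lie_hom_iter hpi) subrr.
by rewrite (phi_fix i ni) (lie_hom0 hpi) subrr subr0.
Qed.
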